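(* Let $R$ be a finite ring. Then $R$ is $4$-centralizer if and only if $\Pr(R) = \frac{5}{8}$.
   Context: Rings are associative; no identity element is assumed. For a finite ring $R$ and $x \in R$, the centralizer of $x$ is $C_R(x) = \{s \in R : xs = sx\}$. Put $\operatorname{Cent}(R) = \{C_R(x) : x \in R\}$; $R$ is called $n$-centralizer if $|\operatorname{Cent}(R)| = n$. The commuting probability of $R$ is $\Pr(R) = \frac{|\{(r,s) \in R \times R : rs = sr\}|}{|R|^2}$. *)

(* Defs.v *)
From HB Require Import structures.
From mathcomp Require Import all_boot all_order all_algebra.

Set Implicit Arguments.
Unset Strict Implicit.
Unset Printing Implicit Defensive.

Import GRing.Theory.
Local Open Scope ring_scope.

(* All MathComp (semi)ring structures carry a multiplicative identity (the     *)
(* pz/nz variants differ only in whether 1 != 0), so associative rings without *)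
(* an assumed identity are introduced here, on top of zmodType.                *)
HB.mixin Record Zmodule_isRng R of GRing.Zmodule R := {
  rngmul : R -> R -> R;
  rngmulA : associative rngmul;
  rngmulDl : left_distributive rngmul +%R;
  rngmulDr : right_distributive rngmul +%R
}.

#[short(type="rngType")]
HB.structure Definition Rng := {R of GRing.Zmodule R & Zmodule_isRng R}.

#[short(type="finRngType")]
HB.structure Definition FinRng := {R of Rng R & Finite R}.

Definition rng_cent (R : finRngType) (x : R) : {set R} :=
  [set s | rngmul x s == rngmul s x].

Definition Cent (R : finRngType) : {set {set R}} :=
  [set rng_cent x | x : R].

Definition n_centralizer (n : nat) (R : finRngType) : Prop :=
  #|Cent R| = n.

Definition commuting_prob (R : finRngType) : rat :=
  #|[set p : R * R | rngmul p.1 p.2 == rngmul p.2 p.1]|%:R / #|R|%:R ^+ 2.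

(* Main.v *)
Require Import Defs.
From mathcomp Require Import all_boot all_order all_algebra.
From mathcomp Require Import zify.

(**
  Both conditions are equivalent, for noncommutative [R] with center [Z], to
  [R] being a union of four cosets [Z], [x + Z], [y + Z], [x + y + Z].
  If [x] and [y] do not commute then [R], [C(x)], [C(y)], [C(x + y)] are
  distinct.  If there are no other centralizers, then any two of the last three
  meet in [Z], and for [w] in [C(x)] outside [Z] one has [C(w) = C(x)], whence
  [C(y + w) = C(x + y)]; thus [w - x] lies in [C(x)] and in [C(x + y)], so in
  [Z].  For the probability, a proper centralizer has at most [#|R| / 2]
  elements, so that [Pr(R) = 5/8] forces [#|R| <= 4 #|Z|]; conversely if
  [#|R| = 4 #|Z|], each proper centralizer is exactly [Z] together with
  one further coset of [Z].
*)

Set Implicit Arguments.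
Unset Strict Implicit.
Unset Printing Implicit Defensive.

Import GRing.Theory Num.Theory.
Local Open Scope ring_scope.

Section Rng.
Variable R : finRngType.
Implicit Types x y z s t w : R.

(** * Centralizers as additive subgroups *)

Lemma rngmul0r x : rngmul 0 x = 0.
Proof. by apply: (addrI (rngmul 0 x)); rewrite -rngmulDl !addr0. Qed.

Lemma rngmulr0 x : rngmul x 0 = 0.
Proof. by apply: (addrI (rngmul x 0)); rewrite -rngmulDr !addr0. Qed.

Lemma rngmulNr x y : rngmul (- x) y = - rngmul x y.
Proof. by apply/eqP; rewrite -addr_eq0 -rngmulDl addNr rngmul0r. Qed.

Lemma rngmulrN x y : rngmul x (- y) = - rngmul x y.
Proof. by apply/eqP; rewrite -addr_eq0 -rngmulDr addNr rngmulr0. Qed.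

Lemma rng_centC x y : (x \in rng_cent y) = (y \in rng_cent x).
Proof. by rewrite !inE eq_sym. Qed.

Lemma rng_cent_id x : x \in rng_cent x.
Proof. by rewrite inE. Qed.

Lemma rng_cent_zmod x : zmod_closed (rng_cent x).
Proof.
split=> [|s t]; rewrite !inE ?rngmul0r ?rngmulr0 // => /eqP xs /eqP xt.
by rewrite rngmulDl rngmulDr rngmulNr rngmulrN xs xt.
Qed.

Lemma rng_cent0 x : 0 \in rng_cent x.
Proof. by have [] := rng_cent_zmod x. Qed.

Lemma rng_centB x s t : s \in rng_cent x -> t \in rng_cent x ->
  s - t \in rng_cent x.
Proof. by have [_] := rng_cent_zmod x; apply. Qed.

Lemma rng_centN x s : s \in rng_cent x -> - s \in rng_cent x.
Proof. by rewrite -[- s]add0r; apply: rng_centB; apply: rng_cent0. Qed.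

Lemma rng_centD x s t : s \in rng_cent x -> t \in rng_cent x ->
  s + t \in rng_cent x.
Proof. by move=> xs /rng_centN xt; rewrite -[t]opprK rng_centB. Qed.

Lemma rng_centDl x s t : s \in rng_cent x ->
  (s + t \in rng_cent x) = (t \in rng_cent x).
Proof.
move=> xs; apply/idP/idP => [xst|]; last exact: rng_centD.
by rewrite -(addKr s t) addrC rng_centB.
Qed.

Lemma rng_centDr x s t : t \in rng_cent x ->
  (s + t \in rng_cent x) = (s \in rng_cent x).
Proof. by rewrite addrC; apply: rng_centDl. Qed.

(** * The center and bounds on proper centralizers *)

Definition rng_center : {set R} := [set z | rng_cent z == setT].

Lemma rng_centerP z : reflect (forall x, z \in rng_cent x) (z \in rng_center).
Proof.
rewrite inE; apply: (iffP eqP) => [zT x|zC]; first by rewrite rng_centC zT inE.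
by apply/setP => x; rewrite rng_centC zC inE.
Qed.

Lemma rng_centerPn x : reflect (exists y, y \notin rng_cent x) (x \notin rng_center).
Proof.
apply: (iffP idP) => [|[y xy]].
  by rewrite inE -subTset => /subsetPn[y _]; exists y.
by apply: contra xy => /rng_centerP/(_ y); rewrite rng_centC.
Qed.

Lemma rng_cent_centerD x z : z \in rng_center -> rng_cent (x + z) = rng_cent x.
Proof.
move=> /rng_centerP zC; apply/setP => s.
by rewrite rng_centC rng_centDr // rng_centC.
Qed.

(** If [y] does not commute with [x], the translate [y + C(x)] is disjoint from [C(x)] and equally
    large. *)
Lemma leq_card_rng_cent x : x \notin rng_center -> (#|rng_cent x|.*2 <= #|R|)%N.
Proof.
case/rng_centerPn => y xy; rewrite -addnn -{2}(card_imset _ (addrI y)).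
rewrite -cardsUI -setIC (_ : _ :&: _ = set0) ?cards0 ?addn0 ?max_card //.
apply/setP => s; rewrite in_set0; apply/negbTE/negP; case/setIP.
by case/imsetP => t xt ->; rewrite rng_centDr // (negPf xy).
Qed.

(** The disjoint cosets [Z] and [x + Z] both lie in [C(x)]. *)
Lemma card_rng_cent_geq x : x \notin rng_center ->
  (#|rng_center|.*2 <= #|rng_cent x|)%N.
Proof.
move=> xZ; rewrite -addnn -{2}(card_imset _ (addrI x)) -cardsUI.
rewrite (_ : _ :&: _ = set0) ?cards0 ?addn0.
  apply/subset_leq_card/subsetP => s /setUP[/rng_centerP //|].
  by case/imsetP => z /rng_centerP zC ->; rewrite rng_centD ?rng_cent_id.
apply/setP => s; rewrite in_set0; apply/negbTE/negP; case/setIP=> sZ.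
case/imsetP => z zZ sE; case/negP: xZ; move: sZ.
by rewrite sE !inE rng_cent_centerD.
Qed.

(** * Four cosets of the center and four centralizers *)

Definition four_cosets x y : {set R} :=
  [set x *+ (p.1.1 : bool) + y *+ (p.1.2 : bool) + p.2
  | p in setX [set: bool * bool] rng_center].

Lemma mem_four_cosets x y (a b : bool) w :
  w - (x *+ a + y *+ b) \in rng_center -> w \in four_cosets x y.
Proof.
move=> wZ; apply/imsetP; exists ((a, b), w - (x *+ a + y *+ b)).
  by rewrite !inE in wZ *.
by rewrite addrC subrK.
Qed.

(** The parametrisation is injective: commuting with [y] detects the coefficient of [x], commuting
    with [x] that of [y], and the central part is then found by cancellation. *)
Lemma card_four_cosets x y : y \notin rng_cent x ->
  #|four_cosets x y| = (4 * #|rng_center|)%N.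
Proof.
move=> xy; rewrite card_in_imset ?cardsX ?cardsT ?card_prod ?card_bool //.
move=> [[a b] z] [[a' b'] z'] /setXP[_ /= /rng_centerP zC].
move=> /setXP[_ /= /rng_centerP zC'] E.
have yx : x \notin rng_cent y by rewrite rng_centC.
have cmul (u : R) (c : bool) : u *+ c \in rng_cent u.
  by rewrite mulrb; case: c; rewrite ?rng_cent_id ?rng_cent0.
have ncmul (u v : R) (c : bool) : u \notin rng_cent v -> (u *+ c \in rng_cent v) = ~~ c.
  by rewrite mulrb; case: c => [/negPf|_]; rewrite ?rng_cent0.
have aE : a = a'.
  have := congr1 (fun s => s \in rng_cent y) E.
  by rewrite !(rng_centDr _ (zC _), rng_centDr _ (zC' _), rng_centDr _ (cmul y _)) !ncmul // => /negb_inj.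
have bE : b = b'.
  have := congr1 (fun s => s \in rng_cent x) E.
  by rewrite !(rng_centDr _ (zC _), rng_centDr _ (zC' _), rng_centDl _ (cmul x _)) !ncmul // => /negb_inj.
by move: E; rewrite aE bE => /addrI->.
Qed.

Lemma four_cosetsT x y : y \notin rng_cent x ->
  (four_cosets x y == setT) = (#|R| == 4 * #|rng_center|)%N.
Proof.
by move=> xy; rewrite -(card_four_cosets xy) eqEcard subsetT cardsT eqn_leq max_card andbT.
Qed.

(** Here [setT] stands for the centralizer of [0]. *)
Definition four_cents x y : {set {set R}} :=
  setT |: (rng_cent x |: (rng_cent y |: [set rng_cent (x + y)])).

Lemma four_centsP x y (A : {set R}) :
  reflect [\/ A = setT, A = rng_cent x, A = rng_cent y | A = rng_cent (x + y)]
    (A \in four_cents x y).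
Proof.
by rewrite !in_setU1 in_set1; apply: (iffP or4P) => -[] /eqP; constructor.
Qed.

Lemma four_cents_sub x y : four_cents x y \subset Cent R.
Proof.
rewrite !subUset !sub1set !imset_f ?andbT //.
apply/imsetP; exists 0 => //; apply/esym/setP => s.
by rewrite rng_centC rng_cent0 inE.
Qed.

(** Membership of [x] and [y] separates the four sets: [setT] contains both, [C(x)] only [x], [C(y)]
    only [y], and [C(x + y)] neither. *)
Lemma card_four_cents x y : y \notin rng_cent x -> #|four_cents x y| = 4.
Proof.
move=> xy; have yx : x \notin rng_cent y by rewrite rng_centC.
have neq (A B : {set R}) s : s \in A -> s \notin B -> A == B = false.
  by move=> sA; apply: contraNF => /eqP <-.
have sx : y \notin rng_cent (x + y).
  by rewrite rng_centC rng_centDr ?rng_cent_id.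
have sy : x \notin rng_cent (x + y).
  by rewrite rng_centC rng_centDl ?rng_cent_id.
rewrite !cardsU1 cards1 !in_setU1 !in_set1.
rewrite (neq _ _ y _ xy) ?inE // (neq _ _ x _ yx) ?inE //.
rewrite (neq _ _ x _ sy) ?inE // (neq _ _ x _ yx) ?rng_cent_id //.
by rewrite (neq _ _ x _ sy) ?rng_cent_id // (neq _ _ y _ sx) ?rng_cent_id.
Qed.

Lemma four_centsE x y : y \notin rng_cent x ->
  (#|Cent R| == 4) = (Cent R \subset four_cents x y).
Proof.
move=> xy; rewrite -(card_four_cents xy) eq_sym.
by rewrite (subset_leqif_cards (four_cents_sub x y)) eqEsubset four_cents_sub.
Qed.

(** * Rings with exactly four centralizers *)

Section FourCentralizers.
Hypothesis Cent4 : #|Cent R| = 4.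

Lemma rng_cent_four x y w : y \notin rng_cent x -> rng_cent w \in four_cents x y.
Proof.
move=> xy; have /subsetP : Cent R \subset four_cents x y.
  by rewrite -four_centsE // Cent4.
by apply; apply: imset_f.
Qed.

(** Such a [z] also commutes with [x + y], so it lies in each of the four sets that [C(w)] can
    be. *)
Lemma rng_center_cent2 x y z : y \notin rng_cent x ->
  z \in rng_cent x -> z \in rng_cent y -> z \in rng_center.
Proof.
move=> xy zx zy; apply/rng_centerP => w.
case/four_centsP: (rng_cent_four w xy) => -> //.
by rewrite rng_centC rng_centD 1?rng_centC.
Qed.

Lemma rng_cent_coset x y w : y \notin rng_cent x -> w \in rng_cent x ->
  w \notin rng_center -> w - x \in rng_center.
Proof.
move=> xy wx wZ.
have yw : w \notin rng_cent y by apply: contra wZ; apply: rng_center_cent2 wx.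
have xxy : x + y \notin rng_cent x by rewrite rng_centDl ?rng_cent_id.
have wxy : w \notin rng_cent (x + y).
  by apply: contra wZ; apply: rng_center_cent2 wx; rewrite // rng_centC.
(* As [w] lies in its own centralizer, [yw], [wxy] and [wZ] exclude the other three values. *)
have Cwx : rng_cent w = rng_cent x.
  case/four_centsP: (rng_cent_four w xy) => // Cw.
  - by move: wZ; rewrite inE Cw eqxx.
  - by move: yw; rewrite -Cw rng_cent_id.
  - by move: wxy; rewrite -Cw rng_cent_id.
(* The classification is now applied to the noncommuting pair [w], [y]. Both [setT] and [C(w)]
   contain [w], and [C(y)] contains [y], whereas [C(x + y)] contains neither. *)
have Cxy : rng_cent (x + y) = rng_cent (w + y).
  have wy : y \notin rng_cent w by rewrite Cwx.
  case/four_centsP: (rng_cent_four (x + y) wy) => // Cw.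
  - by move: wxy; rewrite Cw inE.
  - by move: wxy; rewrite Cw rng_cent_id.
  - have := rng_cent_id y.
    by rewrite -Cw rng_centC rng_centDr ?rng_cent_id // rng_centC (negPf xy).
apply: (rng_center_cent2 xxy); first by rewrite rng_centB ?rng_cent_id.
have -> : w - x = (w + y) - (x + y) by rewrite opprD addrACA subrr addr0.
by rewrite rng_centB ?rng_cent_id // Cxy rng_cent_id.
Qed.

Lemma four_cosets_full x y : y \notin rng_cent x -> four_cosets x y = setT.
Proof.
move=> xy; apply/setP => w; rewrite [RHS]inE.
have [wZ|wZ] := boolP (w \in rng_center).
  by apply: (@mem_four_cosets _ _ false false); rewrite addr0 subr0.
have yx : x \notin rng_cent y by rewrite rng_centC.
have xyx : x \notin rng_cent (x + y) by rewrite rng_centC rng_centDl ?rng_cent_id.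
(* The value of [C(w)] selects the coset: if [C(w) = C(u)] with [u] among [x], [y], [x + y], then
   [w] lies in [C(u)], hence in [u + Z]. *)
case/four_centsP: (rng_cent_four w xy) => Cw.
- by move: wZ; rewrite inE Cw eqxx.
- apply: (@mem_four_cosets _ _ true false); rewrite addr0.
  by apply: rng_cent_coset xy _ wZ; rewrite -Cw rng_cent_id.
- apply: (@mem_four_cosets _ _ false true); rewrite add0r.
  by apply: rng_cent_coset yx _ wZ; rewrite -Cw rng_cent_id.
- apply: (@mem_four_cosets _ _ true true).
  by apply: rng_cent_coset xyx _ wZ; rewrite -Cw rng_cent_id.
Qed.

End FourCentralizers.

Lemma Cent4_card_center x y : y \notin rng_cent x ->
  n_centralizer 4 R <-> #|R| = (4 * #|rng_center|)%N.
Proof.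
move=> xy; split=> [Cent4|/eqP].
  by apply/eqP; rewrite -(four_cosetsT xy) four_cosets_full.
(* Centralizers are constant on cosets of [Z], so only the representatives [0], [x], [y], [x + y]
   matter. *)
rewrite -(four_cosetsT xy) => /eqP cosT; apply/eqP; rewrite (four_centsE xy).
apply/subsetP => _ /imsetP[w _ ->]; have := in_setT w; rewrite -cosT.
case/imsetP => [[[a b] z]] /setXP[_ zZ] -> /=; rewrite rng_cent_centerD //.
case: a b => [] [] /=; rewrite ?addr0 ?add0r !in_setU1 ?in_set1 ?eqxx ?orbT //.
suff -> : rng_cent (0 : R) = setT by rewrite eqxx.
by apply/setP => s; rewrite rng_centC rng_cent0 inE.
Qed.

(** * The commuting probability *)

Lemma card_commuting_pairs :
  #|[set p : R * R | rngmul p.1 p.2 == rngmul p.2 p.1]| =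
  (\sum_(x : R) #|rng_cent x|)%N.
Proof.
rewrite -sum1dep_card -(pair_big_dep xpredT (fun x y => rngmul x y == rngmul y x) (fun _ _ => 1%N)) /=.
by apply: eq_bigr => x _; rewrite sum1dep_card.
Qed.

Lemma commuting_probP (p := (\sum_(x : R) #|rng_cent x|)%N) :
  commuting_prob R = 5%:R / 8%:R <-> (8 * p = 5 * #|R| ^ 2)%N.
Proof.
rewrite /commuting_prob card_commuting_pairs -/p.
have R0 : #|R|%:R != 0 :> rat.
  by rewrite pnatr_eq0 -lt0n; apply/card_gt0P; exists 0.
split=> [/eqP|E].
  rewrite eqr_div ?expf_neq0 // -natrX -!natrM eqr_nat => /eqP.
  by rewrite mulnC => ->.
apply/eqP; rewrite eqr_div ?expf_neq0 // -natrX -!natrM eqr_nat.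
by rewrite mulnC E.
Qed.

Lemma sum_rng_cent : (\sum_(x : R) #|rng_cent x| =
  #|rng_center| * #|R| + \sum_(x | x \notin rng_center) #|rng_cent x|)%N.
Proof.
rewrite (bigID (mem rng_center)) /=; congr addn.
by rewrite -sum_nat_const; apply: eq_bigr => x; rewrite inE => /eqP->; rewrite cardsT.
Qed.

Lemma card_noncenter : (#|rng_center| + #|[pred x | x \notin rng_center]| = #|R|)%N.
Proof. exact: cardC. Qed.

Lemma commuting_prob_card_center x y : y \notin rng_cent x ->
  commuting_prob R = 5%:R / 8%:R <-> #|R| = (4 * #|rng_center|)%N.
Proof.
move=> xy; rewrite commuting_probP sum_rng_cent.
have Z4 : (4 * #|rng_center| <= #|R|)%N.
  by rewrite -(card_four_cosets xy) max_card.
have R0 : (0 < #|R|)%N by apply/card_gt0P; exists 0.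
have nE := card_noncenter; rewrite mulnDr.
set S := (\sum_(_ | _) _)%N; split=> E.
  have : (S * 2 <= #|[pred x | x \notin rng_center]| * #|R|)%N.
    rewrite -sum_nat_const big_distrl /=; apply: leq_sum => w wZ.
    by rewrite muln2 leq_card_rng_cent.
  (* With n = [#|R|] and z = [#|rng_center|], the bound on [S] gives 5n^2 <= 8zn + 4(n - z)n.
     Cancelling n > 0 leaves n <= 4z, and [Z4] is the reverse inequality. *)
  nia.
(* When n = 4z, the bounds 2z <= |C(w)| <= n/2 coincide. *)
have -> : S = (#|[pred x | x \notin rng_center]| * (2 * #|rng_center|))%N.
  rewrite -sum_nat_const; apply: eq_bigr => w wZ.
  have := leq_card_rng_cent wZ; have := card_rng_cent_geq wZ; lia.
nia.
Qed.

End Rng.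

Theorem theorem3p1 (R : finRngType) :
  n_centralizer 4 R <-> commuting_prob R = 5%:R / 8%:R.
Proof.
have [/existsP[x /existsP[y xy]]|] := boolP [exists x : R, exists y, y \notin rng_cent x].
  by rewrite (Cent4_card_center xy) (commuting_prob_card_center xy).
(* In the commutative case both conditions fail: there is a single centralizer, and 8n^2 = 5n^2 is
   impossible for n > 0. *)
rewrite negb_exists => /forallP abel.
have CT (x : R) : rng_cent x = setT.
  apply/setP => y; rewrite [RHS]inE.
  by move: (abel x); rewrite negb_exists => /forallP/(_ y); rewrite negbK.
have sumE : (\sum_(x : R) #|rng_cent x| = #|R| * #|R|)%N.
  by rewrite -sum_nat_const; apply: eq_bigr => x _; rewrite CT cardsT.
rewrite commuting_probP sumE; split=> [Cent4|].
  suff : (#|Cent R| <= 1)%N by rewrite Cent4.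
  rewrite -(cards1 [set: R]); apply/subset_leq_card/subsetP => _ /imsetP[x _ ->].
  by rewrite CT inE.
have : (0 < #|R|)%N by apply/card_gt0P; exists 0.
by nia.
Qed.
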